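(* Let $n\ge d\ge 1$ be integers and let $f=(f_1,\dots,f_n)^\top:\mathbb{R}^d\to\mathbb{R}^n$ be differentiable with Jacobian $J$. Assume: (i) there is $L_f>0$ with $\|f(x)-f(y)\|\le L_f\|x-y\|$ for all $x,y\in\mathbb{R}^d$; (ii) there are $\nu\in(0,1]$ and $\mathcal{H}_\nu>0$ with $\|J(x)-J(y)\|\le \mathcal{H}_\nu\|x-y\|^\nu$ for all $x,y\in\mathbb{R}^d$; (iii) $x^*\in\mathbb{R}^d$ satisfies $f(x^* )=0$ and $\mu=\sigma_{\min}(J(x^* ))>0$. Run the IGN algorithm (described in the context) from $x^0\in\mathbb{R}^d$ with $H^0=J(x^0)^\top J(x^0)$ and $G^0=(H^0)^{-1}$, where $$\|x^0-x^*\|\le\left(\frac{\mu^2}{4L_f\mathcal{H}_\nu n}\right)^{1/\nu}.$$ Then $H^t\succeq(\mu^2/2)I$ and $\sigma_{\min}(I+(V^t)^\top G^tU^t)>0$ for all $t\ge0$. Additionally, there exists a sequence $\{r_t\}_{t\ge 0}$ such that $\|x^t-x^*\|\le r_t$ and $$r_{t+1}\le c^{(1+\nu)^{\lfloor t/n\rfloor-1}}\,r_t\quad\text{for all } t\ge n,\qquad\text{where } c=1-\frac1n\left(1-\left(\frac{1}{2(1+\nu)}\right)^{1+\nu}\right).$$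
   Context: $\|\cdot\|$ is the Euclidean norm for vectors and the spectral norm for matrices; $\sigma_{\min}$ is the smallest singular value; $I$ is an identity matrix; $\succeq$ is the Loewner order on symmetric matrices. For $f=(f_1,\dots,f_n)^\top$, $g_i(x)=\nabla f_i(x)\in\mathbb{R}^d$ and $J(x)=[g_1(x),\dots,g_n(x)]^\top\in\mathbb{R}^{n\times d}$. IGN algorithm. Initialize with $x^0\in\mathbb{R}^d$, $z_i^0=x^0$ for $i=1,\dots,n$, $u^0=\sum_{i=1}^n\big(g_i(z_i^0)^\top z_i^0-f_i(z_i^0)\big)g_i(z_i^0)$, $H^0=J(x^0)^\top J(x^0)=\sum_{i=1}^n g_i(z_i^0)g_i(z_i^0)^\top$, $G^0=(H^0)^{-1}$. For $t=0,1,2,\dots$, with $i_t=(t \bmod n)+1$: - $x^{t+1}=G^tu^t$; - $U^t=[-g_{i_t}(z_{i_t}^t),\ g_{i_t}(x^{t+1})]\in\mathbb{R}^{d\times2}$ and $V^t=[g_{i_t}(z_{i_t}^t),\ g_{i_t}(x^{t+1})]\in\mathbb{R}^{d\times2}$; - $u^{t+1}=u^t-\big(g_{i_t}(z_{i_t}^t)^\top z_{i_t}^t-f_{i_t}(z_{i_t}^t)\big)g_{i_t}(z_{i_t}^t)+\big(g_{i_t}(x^{t+1})^\top x^{t+1}-f_{i_t}(x^{t+1})\big)g_{i_t}(x^{t+1})$; - $H^{t+1}=H^t-g_{i_t}(z_{i_t}^t)g_{i_t}(z_{i_t}^t)^\top+g_{i_t}(x^{t+1})g_{i_t}(x^{t+1})^\top$;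 - $G^{t+1}=G^t-G^tU^t\big(I+(V^t)^\top G^tU^t\big)^{-1}(V^t)^\top G^t$; - $z_i^{t+1}=x^{t+1}$ if $i=i_t$, and $z_i^{t+1}=z_i^t$ otherwise. *)

(* Defs.v *)
From HB Require Import structures.
From mathcomp Require Import all_boot all_order all_algebra.
From mathcomp Require Import boolp classical_sets reals topology normedtype.
From mathcomp Require Import derive exp.

Set Implicit Arguments.
Unset Strict Implicit.
Unset Printing Implicit Defensive.

Import Order.TTheory GRing.Theory Num.Theory.
Import numFieldNormedType.Exports.

Local Open Scope classical_set_scope.
Local Open Scope ring_scope.

(* The library norm `|x| on matrices is the max norm, hence the explicit
   Euclidean and spectral norms below; differentiability does not depend on
   the choice of norm. *)
Definition norm2 (R : realType) (m : nat) (x : 'cV[R]_m) : R :=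
  Num.sqrt (\sum_i x i 0 ^+ 2).

Definition dotcv (R : realType) (m : nat) (x y : 'cV[R]_m) : R :=
  (x^T *m y) 0 0.

(* An m x n matrix has min(m, n) singular values: they are computed from the
   smaller of the two Gram matrices, so that 0 is a singular value only when A
   is rank deficient. *)
Definition singular_values (R : realType) (m n : nat) (A : 'M[R]_(m, n)) :
    set R :=
  [set s | 0 <= s /\
    if (n <= m)%N then eigenvalue (A^T *m A) (s ^+ 2)
    else eigenvalue (A *m A^T) (s ^+ 2)].

(* For m, n > 0 the set of singular values is finite and nonempty, so inf and
   sup are its minimum and maximum. *)
Definition sigma_min (R : realType) (m n : nat) (A : 'M[R]_(m, n)) : R :=
  inf (singular_values A).

Definition spectral_norm (R : realType) (m n : nat) (A : 'M[R]_(m, n)) : R :=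
  sup (singular_values A).

Definition psdmx (R : realType) (m : nat) (A : 'M[R]_m) : Prop :=
  A^T = A /\ forall v : 'cV[R]_m, 0 <= dotcv v (A *m v).

(* Loewner order: A is above B. *)
Definition loewner_ge (R : realType) (m : nat) (A B : 'M[R]_m) : Prop :=
  psdmx (A - B).

Definition grad (R : realType) (d : nat) (h : 'cV[R]_d -> R) (x : 'cV[R]_d) :
    'cV[R]_d :=
  \col_j 'D_(delta_mx j 0) h x.

Definition compgrad (R : realType) (d n : nat) (f : 'cV[R]_d -> 'cV[R]_n)
    (i : 'I_n) : 'cV[R]_d -> 'cV[R]_d :=
  grad (fun y => f y i 0).

(* The library Jacobian 'J is the transposed matrix, for maps between row
   vectors. *)
Definition jac (R : realType) (d n : nat) (f : 'cV[R]_d -> 'cV[R]_n)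
    (x : 'cV[R]_d) : 'M[R]_(n, d) :=
  \matrix_(i, j) compgrad f i x j 0.

Record ign_state (R : realType) (d n : nat) := IgnState {
  ign_x : 'cV[R]_d;
  ign_z : 'I_n -> 'cV[R]_d;
  ign_u : 'cV[R]_d;
  ign_H : 'M[R]_d;
  ign_G : 'M[R]_d }.

Section IGN.
Variables (R : realType) (d n : nat) (f : 'cV[R]_d -> 'cV[R]_n).

Let g := compgrad f.

Definition ign_term (i : 'I_n) (z : 'cV[R]_d) : 'cV[R]_d :=
  (dotcv (g i z) z - f z i 0) *: g i z.

Definition ign_init (x0 : 'cV[R]_d) : ign_state R d n :=
  let H0 := (jac f x0)^T *m jac f x0 in
  {| ign_x := x0;
     ign_z := fun=> x0;
     ign_u := \sum_i ign_term i x0;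
     ign_H := H0;
     ign_G := invmx H0 |}.

Definition ign_next (s : ign_state R d n) : 'cV[R]_d := ign_G s *m ign_u s.

Definition ign_U (i : 'I_n) (s : ign_state R d n) : 'M[R]_(d, 2) :=
  row_mx (- g i (ign_z s i)) (g i (ign_next s)).

Definition ign_V (i : 'I_n) (s : ign_state R d n) : 'M[R]_(d, 2) :=
  row_mx (g i (ign_z s i)) (g i (ign_next s)).

Definition ign_core (i : 'I_n) (s : ign_state R d n) : 'M[R]_2 :=
  1%:M + (ign_V i s)^T *m ign_G s *m ign_U i s.

(* invmx is the true inverse only when its argument is invertible. *)
Definition ign_step (i : 'I_n) (s : ign_state R d n) : ign_state R d n :=
  let x' := ign_next s in
  let zi := ign_z s i in
  {| ign_x := x';
     ign_z := fun k => if k == i then x' else ign_z s k;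
     ign_u := ign_u s - ign_term i zi + ign_term i x';
     ign_H := ign_H s - g i zi *m (g i zi)^T + g i x' *m (g i x')^T;
     ign_G := ign_G s -
       ign_G s *m ign_U i s *m invmx (ign_core i s) *m (ign_V i s)^T *m
       ign_G s |}.

(* Components are numbered from 0, so the one updated at step t is t mod n. *)
Definition ign_idx (n_gt0 : (0 < n)%N) (t : nat) : 'I_n :=
  Ordinal (ltn_pmod t n_gt0).

Fixpoint ign (n_gt0 : (0 < n)%N) (x0 : 'cV[R]_d) (t : nat) : ign_state R d n :=
  if t is t'.+1 then ign_step (ign_idx n_gt0 t') (ign n_gt0 x0 t')
  else ign_init x0.

End IGN.

Definition ign_rate (R : realType) (n : nat) (nu : R) : R :=
  1 - n%:R^-1 * (1 - (2 * (1 + nu))^-1 `^ (1 + nu)).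

(* Main.v *)
(* Put e_t = |x^t - xs| and let D be the radius in the hypothesis. While every
   z_i lies within D of xs, H^t differs from J(xs)^T J(xs) by at most mu^2/2
   (each row moves by at most Hnu D^nu and has length at most Lf), so H^t is
   coercive, the Woodbury identity keeps G^t = (H^t)^-1, and
   det (I + V^T G^t U) = det H^{t+1} / det H^t does not vanish. As x^{t+1} is
   the Gauss-Newton point of the linearizations of f at the z_i, the Hoelder
   Taylor remainder gives, with q = 1 / (2 (1 + nu)),
     e_{t+1} / D <= (q / n) \sum_(j < n) (e_{t-j} / D)^(1+nu),
   where indices t - j < 0 stand for 0. Hence e_t <= D b_t for the sequence b
   satisfying this recursion with equality and b_0 = 1. It is nonincreasing,
   and b_{t+1} <= c b_t for t >= n; comparing the sums defining b_{t+1} and b_t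
   term by term raises the bound on the ratio to the power 1 + nu every n
   steps. *)

Require Import Defs.
From HB Require Import structures.
From mathcomp Require Import all_boot all_order all_algebra.
From mathcomp Require Import boolp classical_sets reals topology normedtype.
From mathcomp Require Import derive exp.
From mathcomp Require Import ring lra.
Import Order.TTheory GRing.Theory Num.Theory.
Import numFieldNormedType.Exports.
Local Open Scope ring_scope.

Set Implicit Arguments.
Unset Strict Implicit.
Unset Printing Implicit Defensive.

(** * Quadratic forms and singular values *)

Section Dot.
Context {R : realType}.

Lemma dotcvE m (x y : 'cV[R]_m) : dotcv x y = \sum_i x i 0 * y i 0.
Proof. by rewrite /dotcv mxE; apply: eq_bigr => i _; rewrite mxE. Qed.

Lemma dotcvC m (x y : 'cV[R]_m) : dotcv x y = dotcv y x.
Proof. by rewrite !dotcvE; apply: eq_bigr => i _; rewrite mulrC. Qed.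

Lemma dotcvDl m (x y z : 'cV[R]_m) : dotcv (x + y) z = dotcv x z + dotcv y z.
Proof. by rewrite /dotcv linearD mulmxDl mxE. Qed.

Lemma dotcvDr m (x y z : 'cV[R]_m) : dotcv x (y + z) = dotcv x y + dotcv x z.
Proof. by rewrite /dotcv mulmxDr mxE. Qed.

Lemma dotcvZl m a (x y : 'cV[R]_m) : dotcv (a *: x) y = a * dotcv x y.
Proof. by rewrite /dotcv linearZ -scalemxAl mxE. Qed.

Lemma dotcvZr m a (x y : 'cV[R]_m) : dotcv x (a *: y) = a * dotcv x y.
Proof. by rewrite dotcvC dotcvZl dotcvC. Qed.

Lemma dotcvNl m (x y : 'cV[R]_m) : dotcv (- x) y = - dotcv x y.
Proof. by rewrite -scaleN1r dotcvZl mulN1r. Qed.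

Lemma dotcvNr m (x y : 'cV[R]_m) : dotcv x (- y) = - dotcv x y.
Proof. by rewrite dotcvC dotcvNl dotcvC. Qed.

Lemma dotcv_sumr m (I : finType) (x : 'cV[R]_m) (F : I -> 'cV[R]_m) :
  dotcv x (\sum_i F i) = \sum_i dotcv x (F i).
Proof. by rewrite /dotcv mulmx_sumr summxE. Qed.

Lemma dotcv_mulmx m k (x : 'cV[R]_m) (A : 'M[R]_(m, k)) (y : 'cV[R]_k) :
  dotcv x (A *m y) = dotcv (A^T *m x) y.
Proof. by rewrite /dotcv trmx_mul trmxK mulmxA. Qed.

Lemma dotcv_ge0 m (x : 'cV[R]_m) : 0 <= dotcv x x.
Proof. by rewrite dotcvE; apply: sumr_ge0 => i _; rewrite -expr2 sqr_ge0. Qed.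

Lemma dotcv_eq0 m (x : 'cV[R]_m) : (dotcv x x == 0) = (x == 0).
Proof.
apply/eqP/eqP => [|->]; last by rewrite /dotcv mulmx0 mxE.
rewrite dotcvE => /eqP; rewrite psumr_eq0 => [/allP x0|i _]; last first.
  by rewrite -expr2 sqr_ge0.
apply/matrixP => i j; rewrite ord1 mxE; apply/eqP.
by have := x0 i (mem_index_enum _); rewrite mulf_eq0 orbb.
Qed.

Lemma dotcv_gt0 m (x : 'cV[R]_m) : (0 < dotcv x x) = (x != 0).
Proof. by rewrite lt_def dotcv_ge0 andbT dotcv_eq0. Qed.

Lemma norm2_ge0 m (x : 'cV[R]_m) : 0 <= norm2 x.
Proof. exact: sqrtr_ge0. Qed.

Lemma sqr_norm2 m (x : 'cV[R]_m) : norm2 x ^+ 2 = dotcv x x.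
Proof.
rewrite /norm2 sqr_sqrtr; last by apply: sumr_ge0 => i _; rewrite sqr_ge0.
by rewrite dotcvE.
Qed.

Lemma norm2Z m a (x : 'cV[R]_m) : norm2 (a *: x) = `|a| * norm2 x.
Proof.
apply/eqP; rewrite -(@eqrXn2 _ 2) ?norm2_ge0 ?mulr_ge0 ?norm2_ge0 //.
by rewrite exprMn !sqr_norm2 dotcvZl dotcvZr mulrA real_normK ?num_real// expr2.
Qed.

Lemma norm2_eq0 m (x : 'cV[R]_m) : (norm2 x == 0) = (x == 0).
Proof. by rewrite -(@sqrf_eq0 _ (norm2 x)) sqr_norm2 dotcv_eq0. Qed.

Lemma coord_le_norm2 m (x : 'cV[R]_m) i : `|x i 0| <= norm2 x.
Proof.
rewrite -ler_sqr ?nnegrE ?norm2_ge0// real_normK ?num_real//.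
rewrite sqr_norm2 dotcvE (bigD1 i)//= -expr2 lerDl.
by apply: sumr_ge0 => j _; rewrite -expr2 sqr_ge0.
Qed.

(** For [c > 0], evaluate at the vertex [t = - b / c]. For [c = 0], a nonzero slope would take the
    affine function down to -1 at [t = - (a + 1) / (2 * b)]. *)
Lemma discr_le0_of_ge0 (a b c : R) : 0 <= c ->
  (forall t, 0 <= a + 2 * b * t + c * t ^+ 2) -> b ^+ 2 <= a * c.
Proof.
move=> c0 q0; have [c_gt0|] := ltrP 0 c.
  have := q0 (- b / c); have c1 : c / c = 1 by rewrite divff// gt_eqF.
  suff -> : a + 2 * b * (- b / c) + c * (- b / c) ^+ 2 = (a * c - b ^+ 2) / c.
    by rewrite pmulr_lge0 ?invr_gt0// subr_ge0.
  by field; rewrite gt_eqF.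
move=> c_le0; have {c0 c_le0} c0 : c = 0 by lra.
subst c; rewrite mulr0; have [->|b0] := eqVneq b 0; first by rewrite expr0n.
have := q0 (- (a + 1) / (2 * b)).
suff -> : a + 2 * b * (- (a + 1) / (2 * b)) +
  0 * (- (a + 1) / (2 * b)) ^+ 2 = -1 by lra.
by field.
Qed.

Lemma psdmx_cauchy_schwarz m (M : 'M[R]_m) (x y : 'cV[R]_m) : psdmx M ->
  dotcv x (M *m y) ^+ 2 <= dotcv x (M *m x) * dotcv y (M *m y).
Proof.
move=> [Msym Mge0]; apply: discr_le0_of_ge0 => // t.
suff <- : dotcv (x + t *: y) (M *m (x + t *: y)) =
   dotcv x (M *m x) + 2 * dotcv x (M *m y) * t + dotcv y (M *m y) * t ^+ 2.
  exact: Mge0.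
rewrite mulmxDr -scalemxAr !(dotcvDl, dotcvDr, dotcvZl, dotcvZr).
have -> : dotcv y (M *m x) = dotcv x (M *m y).
  by rewrite dotcv_mulmx Msym dotcvC.
ring.
Qed.

Lemma cauchy_schwarz m (x y : 'cV[R]_m) : `|dotcv x y| <= norm2 x * norm2 y.
Proof.
rewrite -ler_sqr ?nnegrE ?mulr_ge0 ?norm2_ge0//.
rewrite real_normK ?num_real// exprMn !sqr_norm2.
have := @psdmx_cauchy_schwarz m 1%:M x y; rewrite !mul1mx; apply.
by split=> [|v]; rewrite ?trmx1 // mul1mx dotcv_ge0.
Qed.

(** The squared Frobenius norm serves as the constant, with 1 added for strict positivity; a crude
    bound suffices since only its existence is used. *)
Lemma mulmx_norm2_bound m k (A : 'M[R]_(m, k)) :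
  exists2 K : R, 0 < K & forall v, dotcv (A *m v) (A *m v) <= K * dotcv v v.
Proof.
exists (1 + \sum_i dotcv (row i A)^T (row i A)^T) => [|v].
  by rewrite ltr_pwDl// sumr_ge0// => i _; exact: dotcv_ge0.
rewrite mulrDl mul1r mulr_suml dotcvE.
apply: ler_wpDl; first exact: dotcv_ge0.
apply: ler_sum => i _.
have -> : (A *m v) i 0 = dotcv (row i A)^T v.
  by rewrite dotcvE mxE; apply: eq_bigr => j _; rewrite !mxE.
rewrite -expr2 -!sqr_norm2 -exprMn -[leLHS]real_normK ?num_real//.
by rewrite ler_sqr ?nnegrE ?mulr_ge0 ?norm2_ge0// cauchy_schwarz.
Qed.

(** Cauchy-Schwarz for the form of [M], applied to [M v] and [v], gives |Mv|^4 <= (1 + K) |Mv|^2 <v,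
    Mv>. Cancelling |Mv|^2 and using |v|^2 <= K' |Mv|^2 yields the constant 1 / ((1 + K) K'). *)
Lemma psdmx_unit_lower_bound m (M : 'M[R]_m) : psdmx M -> M \in unitmx ->
  exists2 c : R, 0 < c & forall v, c * dotcv v v <= dotcv v (M *m v).
Proof.
move=> Mpsd Mu; have [K K0 MK] := mulmx_norm2_bound M.
have [K' K'0 MK'] := mulmx_norm2_bound (invmx M).
have qK w : dotcv w (M *m w) <= (1 + K) * dotcv w w.
  have := cauchy_schwarz w (M *m w); have := MK w.
  have := dotcv_ge0 w; rewrite -!sqr_norm2.
  have := ler_norm (dotcv w (M *m w)).
  by have := sqr_ge0 (norm2 w - norm2 (M *m w)); nra.
have K1 : 0 < 1 + K by lra.
exists ((1 + K) * K')^-1 => [|v]; first by rewrite invr_gt0 mulr_gt0.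
rewrite ler_pdivrMl ?mulr_gt0//.
have le1 : dotcv v v <= K' * dotcv (M *m v) (M *m v).
  by rewrite -{1 2}(mulKmx Mu v).
suff le2 : dotcv (M *m v) (M *m v) <= (1 + K) * dotcv v (M *m v).
  by apply: le_trans le1 _; rewrite [_ * K']mulrC -mulrA ler_pM2l.
have [->|Mv0] := eqVneq (M *m v) 0.
  by rewrite [X in _ <= _ * X](_ : _ = 0) ?mulr0 /dotcv mulmx0 mxE.
rewrite -dotcv_gt0 in Mv0.
have := psdmx_cauchy_schwarz (M *m v) v Mpsd => le3.
have le4 : dotcv (M *m v) (M *m (M *m v)) * dotcv v (M *m v) <=
   (1 + K) * dotcv (M *m v) (M *m v) * dotcv v (M *m v).
  by rewrite ler_wpM2r ?qK//; case: Mpsd.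
have {le3 le4} := le_trans le3 le4.
by rewrite expr2 -mulrA mulrCA ler_pM2l.
Qed.

(* If [lam] is the supremum of the Rayleigh quotient, then [lam I - A] is
   positive semidefinite, and were it invertible it would be bounded below by
   a positive multiple of the identity, which contradicts the supremum. *)
Lemma symmetric_max_eigenvalue m (A : 'M[R]_m) : (0 < m)%N -> A^T = A ->
  exists2 lam, eigenvalue A lam &
    forall v, dotcv v (A *m v) <= lam * dotcv v v.
Proof.
move=> m0 Asym; have [K K0 AK] := mulmx_norm2_bound A.
pose E := [set q : R | exists2 v, dotcv v v = 1 & q = dotcv v (A *m v)]%classic.
have Eub : has_ubound E.
  exists (1 + K) => _ [v v1 ->].
  have := cauchy_schwarz v (A *m v); have := AK v; rewrite -!sqr_norm2 in v1 *.
  rewrite v1; have := ler_norm (dotcv v (A *m v)).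
  by have := sqr_ge0 (norm2 v - norm2 (A *m v)); nra.
have E0 : (E !=set0)%classic.
  pose e := delta_mx (Ordinal m0) 0 : 'cV[R]_m.
  exists (dotcv e (A *m e)), e => //.
  rewrite dotcvE (bigD1 (Ordinal m0))//= big1 ?addr0 => [|i /negPf i0].
    by rewrite mxE !eqxx mulr1.
  by rewrite mxE i0 mul0r.
have ray v : dotcv v (A *m v) <= sup E * dotcv v v.
  have [->|v0] := eqVneq v 0; first by rewrite /dotcv mulmx0 !mulmx0 !mxE mulr0.
  have nv : norm2 v != 0 by rewrite norm2_eq0.
  have : E ((norm2 v)^-1 * ((norm2 v)^-1 * dotcv v (A *m v))).
    exists ((norm2 v)^-1 *: v); last by rewrite -scalemxAr !dotcvZl !dotcvZr.
    by rewrite dotcvZl dotcvZr -sqr_norm2; field.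
  move/(ub_le_sup Eub) => h.
  rewrite -sqr_norm2 -ler_pdivrMr ?exprn_gt0 ?lt_def ?nv ?norm2_ge0//.
  have -> // : dotcv v (A *m v) / norm2 v ^+ 2 =
    (norm2 v)^-1 * ((norm2 v)^-1 * dotcv v (A *m v)) by field.
exists (sup E) => //; pose M := (sup E)%:M - A.
have Mq v : dotcv v (M *m v) = sup E * dotcv v v - dotcv v (A *m v).
  by rewrite mulmxBl dotcvDr dotcvNr mul_scalar_mx dotcvZr.
have Mpsd : psdmx M.
  split=> [|v]; last by rewrite Mq subr_ge0.
  by rewrite /M linearB /= tr_scalar_mx Asym.
have [Mu|Mnu] := boolP (M \in unitmx); last first.
  rewrite /eigenvalue /eigenspace kermx_eq0 row_free_unit.
  by rewrite -opprB -scaleN1r unitmxZ// unitrN1.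
have [c c0 cM] := psdmx_unit_lower_bound Mpsd Mu.
have : sup E <= sup E - c; last by lra.
apply: ge_sup => // _ [v v1 ->].
by have := cM v; rewrite Mq v1; lra.
Qed.

Lemma symmetric_min_eigenvalue m (A : 'M[R]_m) : (0 < m)%N -> A^T = A ->
  exists2 lam, eigenvalue A lam &
    forall v, lam * dotcv v v <= dotcv v (A *m v).
Proof.
move=> m0 Asym; have [|lam lamE lamA] := @symmetric_max_eigenvalue _ (- A) m0.
  by rewrite linearN /= Asym.
exists (- lam) => [|v].
  have /eigenvalueP[w wA w0] := lamE; apply/eigenvalueP; exists w => //.
  by rewrite scaleNr -wA mulmxN opprK.
by have := lamA v; rewrite mulNmx dotcvNr; lra.
Qed.

(** * Singular values through the Gram matrix *)

Lemma dotcv_gram m k (A : 'M[R]_(m, k)) v :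
  dotcv v (A^T *m A *m v) = dotcv (A *m v) (A *m v).
Proof. by rewrite -mulmxA dotcv_mulmx trmxK. Qed.

Lemma singular_values_eigenvalue m k (A : 'M[R]_(m, k)) s : (k <= m)%N ->
  singular_values A s = (0 <= s /\ eigenvalue (A^T *m A) (s ^+ 2)).
Proof. by rewrite /singular_values /= => ->. Qed.

Lemma eigenvalue_gram m k (A : 'M[R]_(m, k)) a :
  eigenvalue (A^T *m A) a ->
  exists2 v, 0 < dotcv v v & dotcv (A *m v) (A *m v) = a * dotcv v v.
Proof.
(* Eigenvectors of [eigenvalue] are row vectors; the Gram matrix is symmetric, so transposing gives
   a column eigenvector. *)
move=> /eigenvalueP[w wA w0]; exists w^T.
  by rewrite dotcv_gt0 -(inj_eq (@trmx_inj _ _ _)) trmxK linear0.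
by rewrite -dotcv_gram dotcv_mulmx -trmx_mul wA linearZ dotcvZl.
Qed.

Lemma sqrt_singular_value m k (A : 'M[R]_(m, k)) a : (k <= m)%N ->
  eigenvalue (A^T *m A) a -> 0 <= a /\ singular_values A (Num.sqrt a).
Proof.
move=> km aE; have a0 : 0 <= a.
  have [v v0 va] := eigenvalue_gram aE.
  by rewrite -(pmulr_lge0 _ v0) -va dotcv_ge0.
by rewrite singular_values_eigenvalue// sqrtr_ge0 sqr_sqrtr.
Qed.

Lemma gram_sym m k (A : 'M[R]_(m, k)) : (A^T *m A)^T = A^T *m A.
Proof. by rewrite trmx_mul trmxK. Qed.

Lemma spectral_norm_ge0 m k (A : 'M[R]_(m, k)) : 0 <= spectral_norm A.
Proof.
(* When the supremum does not exist, [sup] takes its default value 0. *)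
have [[[s sA] sub]|/sup_out s0] := pselect (has_sup (singular_values A)).
  by case: (sA) => s0 _; apply: le_trans s0 (ub_le_sup sub sA).
by rewrite /spectral_norm s0.
Qed.

(** The square root of the largest eigenvalue of the Gram matrix is a singular value and bounds all
    the others, so the supremum is at least this root. *)
Lemma norm2_mulmx_le m k (A : 'M[R]_(m, k)) v : (0 < k <= m)%N ->
  norm2 (A *m v) <= spectral_norm A * norm2 v.
Proof.
move=> /andP[k0 km].
have [lam lamE lamA] := symmetric_max_eigenvalue k0 (gram_sym A).
have [lam0 lamS] := sqrt_singular_value km lamE.
rewrite -ler_sqr ?nnegrE ?mulr_ge0 ?norm2_ge0 ?spectral_norm_ge0//.
rewrite exprMn !sqr_norm2 -dotcv_gram; apply: le_trans (lamA v) _.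
rewrite ler_wpM2r ?dotcv_ge0// -[leLHS]sqr_sqrtr//.
rewrite ler_sqr ?nnegrE ?sqrtr_ge0 ?spectral_norm_ge0//.
apply: ub_le_sup lamS; exists (Num.sqrt lam) => s.
rewrite singular_values_eigenvalue// => -[s0 /eigenvalue_gram[w w0 wA]].
rewrite -ler_sqr ?nnegrE ?sqrtr_ge0// sqr_sqrtr// -(ler_pM2r w0) -wA.
by rewrite -dotcv_gram.
Qed.

Lemma sigma_min_le_gram m k (A : 'M[R]_(m, k)) v : (0 < k <= m)%N ->
  sigma_min A ^+ 2 * dotcv v v <= dotcv (A *m v) (A *m v).
Proof.
move=> /andP[k0 km].
have [lam lamE lamA] := symmetric_min_eigenvalue k0 (gram_sym A).
have [lam0 lamS] := sqrt_singular_value km lamE.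
rewrite -dotcv_gram; apply: le_trans (lamA v).
have lb0 : lbound (singular_values A) 0 by move=> s [].
rewrite ler_wpM2r ?dotcv_ge0// -[leRHS]sqr_sqrtr//.
rewrite ler_sqr ?nnegrE ?sqrtr_ge0//; last first.
  by apply: lb_le_inf => //; exists (Num.sqrt lam).
by apply: ge_inf lamS; exists 0.
Qed.

(** Positivity of each singular value would not bound the infimum away from 0; the uniform
    coercivity constant [c] of the Gram matrix does, through [Num.sqrt c]. *)
Lemma sigma_min_gt0 m (A : 'M[R]_m) : (0 < m)%N -> A \in unitmx ->
  0 < sigma_min A.
Proof.
move=> m0 Au.
have [lam lamE lamA] := symmetric_min_eigenvalue m0 (gram_sym A).
have [_ lamS] := sqrt_singular_value (leqnn m) lamE.
have [c c0 cA] : exists2 c : R, 0 < c &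
    forall v, c * dotcv v v <= dotcv v (A^T *m A *m v).
  apply: psdmx_unit_lower_bound; last by rewrite unitmx_mul unitmx_tr Au.
  by split=> [|v]; rewrite ?gram_sym ?dotcv_gram ?dotcv_ge0.
apply: (@lt_le_trans _ _ (Num.sqrt c)); first by rewrite sqrtr_gt0.
apply: lb_le_inf => [|s]; first by exists (Num.sqrt lam).
rewrite singular_values_eigenvalue// => -[s0 /eigenvalue_gram[w w0 wA]].
rewrite -ler_sqr ?nnegrE ?sqrtr_ge0// (sqr_sqrtr (ltW c0)) -(ler_pM2r w0) -wA.
by rewrite -dotcv_gram.
Qed.

(** Applied to its own i-th row, [A] produces the squared norm of that row as i-th coordinate. *)
Lemma norm2_row_le m k (A : 'M[R]_(m, k)) i : (0 < k <= m)%N ->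
  norm2 (row i A)^T <= spectral_norm A.
Proof.
move=> km; have := norm2_mulmx_le A (row i A)^T km.
have := coord_le_norm2 (A *m (row i A)^T) i.
have -> : (A *m (row i A)^T) i 0 = norm2 (row i A)^T ^+ 2.
  by rewrite sqr_norm2 dotcvE mxE; apply: eq_bigr => j _; rewrite !mxE.
move=> h /(le_trans h); rewrite ger0_norm ?sqr_ge0// expr2.
have := norm2_ge0 (row i A)^T; rewrite le_eqVlt => /predU1P[<- _|w0].
  exact: spectral_norm_ge0.
by rewrite ler_pM2r.
Qed.

(** An explicit inverse, [1%:M - V^T *m invmx H' *m U], replaces the determinant argument; the cross
    term simplifies because U V^T = H' - H. *)
Lemma woodbury_core_unit m k (H H' : 'M[R]_m) (U V : 'M[R]_(m, k)) :
  H \in unitmx -> H' \in unitmx -> H' = H + U *m V^T ->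
  1%:M + V^T *m invmx H *m U \in unitmx.
Proof.
move=> Hu H'u H'E.
apply: (proj1 (@mulmx1_unit _ _ _ (1%:M - V^T *m invmx H' *m U) _)).
have UV : U *m V^T = H' - H by rewrite H'E addrC addKr.
rewrite mulmxDl mul1mx mulmxBr mulmx1.
suff -> : V^T *m invmx H *m U *m (V^T *m invmx H' *m U) =
   V^T *m invmx H *m U - V^T *m invmx H' *m U.
  by rewrite opprB [X in _ + X]addrC !subrK.
rewrite !mulmxA -(mulmxA _ U) UV mulmxBr -(mulmxA V^T _ H) mulVmx// mulmx1.
by rewrite !mulmxBl -(mulmxA _ H') mulmxV// mulmx1.
Qed.

Lemma woodbury_inverse m k (H H' : 'M[R]_m) (U V : 'M[R]_(m, k)) :
  H \in unitmx -> H' \in unitmx -> H' = H + U *m V^T ->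
  invmx H - invmx H *m U *m invmx (1%:M + V^T *m invmx H *m U) *m V^T *m invmx H
  = invmx H'.
Proof.
move=> Hu H'u H'E; have Cu := woodbury_core_unit Hu H'u H'E.
set C := 1%:M + _ in Cu *; set G := _ - _.
suff H'G : H' *m G = 1%:M by rewrite -[RHS]mulmx1 -H'G mulKmx.
have VGU : V^T *m invmx H *m U = C - 1%:M by rewrite /C addrC addKr.
rewrite /G H'E mulmxBr !mulmxDl mulmxV// !mulmxA mulmxV// mul1mx.
rewrite -(mulmxA U V^T) -(mulmxA U (V^T *m invmx H)) VGU.
rewrite mulmxBr mulmx1 mulmxBl -(mulmxA U C) mulmxV// mulmx1 mulmxBl !mulmxBl.
by rewrite [X in _ - X]addrC subrK mulmxA addrK.
Qed.

End Dot.

(** * First-order Taylor remainder *)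

Section Calculus.
Context {R : realType}.
Local Open Scope classical_set_scope.
Local Open Scope ring_scope.

(** The derivative rule for powers covers positive bases only, so continuity at 0 comes from a
    one-sided limit. *)
Lemma continuous_powR_01 (p : R) : 0 < p ->
  {within `[0, 1], continuous (@powR R ^~ p)}.
Proof.
move=> p0; have cpos x : 0 < x -> {for x, continuous (@powR R ^~ p)}.
  move=> x0; apply/differentiable_continuous; rewrite -derivable1_diffP.
  by apply: derivable_powR; rewrite in_itv/= x0.
apply/continuous_within_itvP => //; split=> [x||].
- by rewrite in_itv/= => /andP[x0 _]; exact: cpos.
- by rewrite powR0 ?gt_eqF//; exact: powR_cvg0.
- by apply: cvg_at_left_filter; exact: cpos.
Qed.

(** The mean value theorem stands in for integration: [psi] subtracts from [phi] its linear part and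
    the primitive of K s^nu, so its derivative is nonpositive on ]0, 1[. *)
Lemma taylor1_holder_le (phi dphi : R -> R) (K nu : R) : 0 < nu ->
  (forall s : R, is_derive s 1 phi (dphi s)) ->
  (forall s : R, 0 <= s <= 1 -> dphi s - dphi 0 <= K * s `^ nu) ->
  phi 1 - phi 0 - dphi 0 <= K / (1 + nu).
Proof.
move=> nu0 dphiP dphiK; have nu1 : 0 < 1 + nu by lra.
pose psi (s : R) := phi s - dphi 0 * s - K / (1 + nu) * s `^ (1 + nu).
have dpsi (s : R) : s \in `]0, 1[%R ->
    is_derive s 1 psi (dphi s - dphi 0 - K * s `^ nu).
  rewrite in_itv/= => /andP[s0 s1].
  have := is_derive1_powR (1 + nu) s0; rewrite [1 + nu - 1]addrC addKr => dpow.
  have dP := dphiP s.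
  rewrite /psi; apply: is_derive_eq.
  by rewrite /GRing.scale /=; field; rewrite gt_eqF.
have cpsi : {within `[0, 1], continuous psi}.
  move=> s; apply: cvgB; first apply: cvgB.
  - apply: continuous_subspaceT => {}s; apply/differentiable_continuous.
    by rewrite -derivable1_diffP; have [] := dphiP s.
  - by apply: continuous_subspaceT => {}s; exact: cvgMr.
  - apply: cvgMr; exact: continuous_powR_01.
have [c] := MVT_segment ler01 dpsi cpsi.
rewrite in_itv/= => /dphiK; rewrite /psi powR0 ?gt_eqF// powR1.
lra.
Qed.

Lemma taylor1_holder (phi dphi : R -> R) (K nu : R) : 0 < nu ->
  (forall s : R, is_derive s 1 phi (dphi s)) ->
  (forall s : R, 0 <= s <= 1 -> `|dphi s - dphi 0| <= K * s `^ nu) ->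
  `|phi 1 - phi 0 - dphi 0| <= K / (1 + nu).
Proof.
move=> nu0 dphiP dphiK; rewrite ler_norml; apply/andP; split; last first.
  apply: taylor1_holder_le => // s /dphiK; exact/le_trans/ler_norm.
have : - phi 1 - - phi 0 - - dphi 0 <= K / (1 + nu); last by lra.
apply: (@taylor1_holder_le (fun s => - phi s) (fun s => - dphi s) _ nu) => // s.
by move=> /dphiK; apply: le_trans; rewrite -opprD -normrN ler_norm.
Qed.

Context {d n : nat}.
Variables (f : 'cV[R]_d -> 'cV[R]_n) (i : 'I_n).
Hypothesis f_diff : forall x, differentiable f x.

Let differentiable_component x : differentiable (fun y => f y i 0) x.
Proof.
apply: (@differentiable_comp _ _ _ _ f (fun z : 'cV[R]_n => z i 0) x) => //.
exact: differentiable_coord.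
Qed.

Lemma derive_compgrad x v :
  'D_v (fun y => f y i 0) x = dotcv (compgrad f i x) v.
Proof.
have df := differentiable_component x.
rewrite deriveE// {1}(matrix_sum_delta v) linear_sum dotcvE.
apply: eq_bigr => j _; rewrite big_ord1 linearZ /= mxE deriveE// mulrC.
by rewrite /GRing.scale.
Qed.

Lemma is_derive_line x v (s : R) : is_derive s 1 (fun s => f (x + s *: v) i 0)
  (dotcv (compgrad f i (x + s *: v)) v).
Proof.
pose F y := f y i 0.
(* The difference quotient along the line is that of the directional derivative at [x + s *: v]. *)
have E : (fun h : R => h^-1 *: (((fun s => F (x + s *: v)) \o shift s) (h *: 1)
    - F (x + s *: v))) =
  (fun h => h^-1 *: ((F \o shift (x + s *: v)) (h *: v) - F (x + s *: v))).
  apply/funext => h /=; congr (_ *: (F _ - _)).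
  by rewrite scalerDl [h *: 1]mulr1 addrCA.
apply: DeriveDef; last first.
  by rewrite -derive_compgrad /derive E.
rewrite /derivable E; apply: diff_derivable; exact: differentiable_component.
Qed.

(** The derivative in the direction of the gradient [g] itself is |g|^2, while the Lipschitz bound
    limits its difference quotients to L |g|. *)
Lemma norm2_compgrad_le L x : 0 <= L ->
  (forall y z, norm2 (f y - f z) <= L * norm2 (y - z)) ->
  norm2 (compgrad f i x) <= L.
Proof.
move=> L0 fL; pose g := compgrad f i x; have := norm2_ge0 g.
rewrite le_eqVlt => /predU1P[<-//|g0]; rewrite -(ler_pM2r g0) -expr2 sqr_norm2.
rewrite -derive_compgrad; apply: limr_le.
  exact/diff_derivable/differentiable_component.
near=> h; have h0 : h != 0 by near: h; exact: nbhs_dnbhs_neq.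
rewrite /GRing.scale /=.
have := coord_le_norm2 (f (h *: g + x) - f x) i.
move=> /le_trans /(_ (fL _ _)); rewrite addrK norm2Z !mxE.
rewrite mulrCA -ler_pdivrMl ?normr_gt0// -normfV -normrM.
exact/le_trans/ler_norm.
Unshelve. all: by end_near. Qed.

Lemma norm2_compgradB_le x y : (0 < d <= n)%N ->
  norm2 (compgrad f i x - compgrad f i y) <= spectral_norm (jac f x - jac f y).
Proof.
move=> dn; have := norm2_row_le (jac f x - jac f y) i dn.
suff -> : (row i (jac f x - jac f y))^T = compgrad f i x - compgrad f i y by [].
by apply/matrixP => j k; rewrite !mxE.
Qed.

Lemma linearization_error_le (H nu : R) x y : 0 < nu -> 0 <= H ->
  (forall x y, norm2 (compgrad f i x - compgrad f i y) <=
    H * norm2 (x - y) `^ nu) ->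
  `|f y i 0 - f x i 0 - dotcv (compgrad f i x) (y - x)| <=
  H / (1 + nu) * norm2 (x - y) `^ (1 + nu).
Proof.
move=> nu0 H0 gH.
have := @taylor1_holder _ _ (H * norm2 (y - x) `^ (1 + nu)) nu nu0
  (is_derive_line x (y - x)).
rewrite scale1r scale0r addr0 [x + (y - x)]addrC subrK.
have -> : norm2 (x - y) = norm2 (y - x).
  by rewrite -opprB -scaleN1r norm2Z normrN1 mul1r.
rewrite mulrAC; apply => s /andP[s0 s1].
rewrite -dotcvNl -dotcvDl; apply: le_trans (cauchy_schwarz _ _) _.
rewrite [1 + nu]addrC.
rewrite powRD ?powRr1 ?norm2_ge0//; last by rewrite gt_eqF// addr_gt0.
rewrite mulrA mulrAC ler_wpM2r ?norm2_ge0//; apply: le_trans (gH _ _) _.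
rewrite addrAC subrr add0r norm2Z ger0_norm// powRM ?norm2_ge0//.
by rewrite -mulrA [s `^ _ * _]mulrC.
Qed.

End Calculus.

(** * Cyclic updates and the majorant sequence *)

Section CyclicUpdates.
Context {T : Type} {n : nat} (n_gt0 : (0 < n)%N).
Variables (x : nat -> T) (z : nat -> 'I_n -> T).
Hypothesis z0 : forall i, z 0 i = x 0.
Hypothesis zS : forall t i,
  z t.+1 i = if i == ign_idx n_gt0 t then x t.+1 else z t i.

(* Component [i] was last refreshed [(t - 1 - i) mod n] steps ago; if that
   exceeds [t] the truncated subtraction yields the initial iterate. *)
Lemma cyclic_updateE t i : z t i = x (t - (t + (n - i.+1)) %% n).
Proof.
elim: t => [|t IHt]; first by rewrite z0 sub0n.
have idxE : (i == ign_idx n_gt0 t) = (n %| (t + (n - i.+1)).+1)%N.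
  rewrite -addnS -subSn// subSS.
  have -> : (n %| t + (n - i))%N = (t + (n - i) == i + (n - i) %[mod n])%N.
    by rewrite subnKC 1?ltnW// modnn.
  by rewrite eqn_modDr (modn_small (ltn_ord i)) eq_sym.
rewrite zS idxE addSn modnS; case: ifP => _; first by rewrite subn0.
by rewrite IHt subSS.
Qed.

(** The ages (t + (n - i.+1)) mod n take each value below n exactly once. For ages beyond t,
    truncation gives the initial iterate on both sides. *)
Lemma sum_cyclic_update {V : nmodType} (F : T -> V) t :
  \sum_i F (z t i) = \sum_(j < n) F (x (t - j)).
Proof.
pose h (i : 'I_n) := Ordinal (ltn_pmod (t + (n - i.+1)) n_gt0).
have h_inj : injective h.
  move=> i j [] /eqP; rewrite eqn_modDl !modn_small; first last.
  - by rewrite -subn_gt0 subKn.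
  - by rewrite -subn_gt0 subKn.
  move=> /eqP hij; apply/val_inj/succn_inj.
  by rewrite -(subKn (ltn_ord i)) hij subKn.
rewrite [RHS](reindex_inj h_inj); apply: eq_bigr => i _.
by rewrite cyclic_updateE.
Qed.

End CyclicUpdates.

(** * The majorant sequence and its rate of decrease *)

Section Majorant.
Context {R : realType}.
Variables (n : nat) (nu : R).
Hypothesis (n_gt0 : (0 < n)%N) (nu_gt0 : 0 < nu).

Let q : R := (2 * (1 + nu))^-1.
Let p : R := 1 + nu.

(** The recursion reaches back n steps and is not structural, so the whole history j -> b_{t-j} is
    carried along, padded with 1 before time 0. *)
Fixpoint majorant_window (t : nat) : nat -> R :=
  if t is t'.+1 then
    fun j => if j is j'.+1 then majorant_window t' j'
             else q / n%:R * \sum_(k < n) majorant_window t' k `^ p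
  else fun=> 1.

Definition majorant (t : nat) : R := majorant_window t 0.

Let majorant_windowE t j : majorant_window t j = majorant (t - j).
Proof. by elim: t j => [|t IHt] [|j] //; rewrite subSS -IHt. Qed.

Lemma majorantS t :
  majorant t.+1 = q / n%:R * \sum_(j < n) majorant (t - j) `^ p.
Proof.
by rewrite /majorant /=; congr (_ * _); apply: eq_bigr => j _;
   rewrite majorant_windowE.
Qed.

Let p_gt0 : 0 < p. Proof. by rewrite addr_gt0. Qed.
Let p_ge1 : 1 <= p. Proof. by rewrite lerDl ltW. Qed.
Let q_gt0 : 0 < q. Proof. by rewrite invr_gt0 mulr_gt0. Qed.
Let q_le1 : q <= 1.
Proof. by rewrite /q invf_le1 ?mulr_gt0//; rewrite -/p; have := p_ge1; lra. Qed.
Let nR_gt0 : 0 < n%:R :> R. Proof. by rewrite ltr0n. Qed.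

Lemma majorant_ge0 t : 0 <= majorant t.
Proof.
case: t => [|t]; first exact: ler01.
rewrite majorantS; apply: mulr_ge0; first by rewrite divr_ge0 ?ltW.
by apply: sumr_ge0 => j _; exact: powR_ge0.
Qed.

Let powR_le (x y : R) : 0 <= x -> x <= y -> x `^ p <= y `^ p.
Proof.
move=> x0 xy; apply: ge0_ler_powR => //; first exact: ltW.
by rewrite nnegrE (le_trans x0).
Qed.

Lemma majorantS_le t : majorant t.+1 <= majorant t.
Proof.
elim/ltn_ind: t => -[|t] IHt.
  rewrite majorantS [leRHS]/1 (eq_bigr (fun=> 1)) => [|j _]; last first.
    by rewrite sub0n powR1.
  by rewrite sumr_const card_ord divfK// gt_eqF.
rewrite 2!majorantS ler_pM2l ?divr_gt0//; apply: ler_sum => j _.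
apply: powR_le; first exact: majorant_ge0.
have [jt|tj] := leqP j t; first by rewrite subSn// IHt// ltnS leq_subr.
(* Here both truncated indices are 0 and the two terms coincide. *)
have -> : (t.+1 - j = 0)%N by apply/eqP; rewrite subn_eq0.
by have -> : (t - j = 0)%N by apply/eqP; rewrite subn_eq0 ltnW.
Qed.

Lemma majorant_antitone : {homo majorant : s t / (s <= t)%N >-> t <= s}.
Proof.
apply: homo_leq => [x|x y z yx zy|t]; first exact: lexx.
  exact: le_trans zy yx.
exact: majorantS_le.
Qed.

Lemma majorant_le1 t : majorant t <= 1.
Proof. exact: (@majorant_antitone 0). Qed.

Let qp_le1 : q `^ p <= 1.
Proof. by have := powR_le (ltW q_gt0) q_le1; rewrite powR1. Qed.

Lemma ign_rate_gt0 : 0 < ign_rate n nu.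
Proof.
have nR1 : 1 <= n%:R :> R by rewrite ler1n.
rewrite /ign_rate -/q -/p subr_gt0 mulrC ltr_pdivrMr// mul1r.
by have := powR_gt0 p q_gt0; lra.
Qed.

Lemma ign_rate_le1 : ign_rate n nu <= 1.
Proof.
rewrite /ign_rate -/q -/p lerBlDr lerDl; apply: mulr_ge0.
  by rewrite invr_ge0 ltW.
by rewrite subr_ge0.
Qed.

(* The sums defining consecutive values differ only in their newest and oldest
   terms, and [q] times the oldest term bounds [majorant t]. *)
Lemma majorant_linear t : (n <= t)%N ->
  majorant t.+1 <= ign_rate n nu * majorant t.
Proof.
case: t => [|s]; first by rewrite leqNgt n_gt0.
have [m nE] : exists m, n = m.+1 by exists n.-1; rewrite prednK.
move=> ns; have ms : (m <= s)%N by rewrite -ltnS -nE.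
pose X := majorant (s - m) `^ p; pose Y := majorant s.+1 `^ p.
have sE : majorant s.+2 = majorant s.+1 + q / n%:R * (Y - X).
  rewrite majorantS [majorant s.+1 in RHS]majorantS -mulrDr; congr (_ * _).
  rewrite [in LHS]nE [in RHS]nE big_ord_recl big_ord_recr /= subn0.
  under eq_bigr do rewrite /bump /= add1n subSS.
  by rewrite -/X -/Y; ring.
have sX : majorant s.+1 <= q * X.
  rewrite majorantS -mulrA ler_pM2l// ler_pdivrMl//.
  apply: (@le_trans _ _ (\sum_(j < n) X)); last first.
    by rewrite sumr_const card_ord mulr_natl.
  apply: ler_sum => j _; apply: powR_le; first exact: majorant_ge0.
  by apply: majorant_antitone; rewrite leq_sub2l// -ltnS -nE.
(* Since [p >= 1] and the values are at most 1, [X <= majorant (s - m)]; hence [sX] gives majorant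
   s.+1 <= q majorant (s - m), to be raised to the power [p]. *)
have YX : Y <= q `^ p * X.
  rewrite -powRM ?majorant_ge0 ?(ltW q_gt0)//; apply: powR_le => //.
    exact: majorant_ge0.
  apply: (le_trans sX); rewrite ler_pM2l// /X.
  have := majorant_ge0 (s - m); rewrite le_eqVlt => /predU1P[<-|m0].
    by rewrite powR0// gt_eqF.
  by apply: ge1r_powR; rewrite // m0 majorant_le1.
rewrite sE /ign_rate -/q -/p mulrBl mul1r lerD2l -lerN2 opprK -mulrN opprB.
rewrite -[q / _]mulrC -!mulrA ler_pM2l ?invr_gt0//.
(* The decrease satisfies q (X - Y) >= (1 - q^p) q X >= (1 - q^p) majorant s.+1. *)
have : (1 - q `^ p) * majorant s.+1 <= (1 - q `^ p) * (q * X).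
  by rewrite ler_wpM2l// subr_ge0.
have : q * Y <= q * (q `^ p * X) by rewrite ler_pM2l.
lra.
Qed.

(** Each term of the newer sum is compared with its predecessor by the induction hypothesis, at an
    index at most n steps back; the power 1 + nu in the recursion then advances the exponent by
    one. *)
Lemma majorant_superlinear t : (n <= t)%N ->
  majorant t.+1 <= ign_rate n nu `^ ((1 + nu) ^+ (t %/ n - 1)) * majorant t.
Proof.
have c_gt0 := ign_rate_gt0; have c_le1 := ign_rate_le1.
(* For t < 2n the exponent (1 + nu)^0 equals 1 and the linear bound is the claim. *)
elim/ltn_ind: t => t IHt nt; have [tn2|n2t] := ltnP t (n + n).
  rewrite (_ : t %/ n - 1 = 0)%N ?expr0 ?powRr1 ?(ltW c_gt0) ?majorant_linear//.
  by apply/eqP; rewrite subn_eq0 -ltnS ltn_divLR// mul2n -addnn.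
case: t => [|s] in IHt nt n2t *; first by rewrite leqNgt n_gt0 in nt.
set rho := _ `^ _.
rewrite majorantS [majorant s.+1]majorantS mulrCA ler_pM2l ?divr_gt0//.
rewrite mulr_sumr; apply: ler_sum => j _.
have jn := ltn_ord j.
have js : (j <= s)%N by rewrite -ltnS (leq_trans jn).
have sj : (n <= s - j)%N.
  by rewrite leq_subRL// -ltnS (leq_trans _ n2t)// -addSn leq_add2r.
pose k := (s.+1 %/ n - 2)%N.
have kE : (s.+1 %/ n - 1 = k.+1)%N.
  rewrite /k -subSn// leq_divRL//.
  by rewrite mul2n -addnn.
have rhoE : rho = (ign_rate n nu `^ ((1 + nu) ^+ k)) `^ p.
  by rewrite -powRrM /rho kE exprSr.
rewrite rhoE subSn// -powRM ?powR_ge0 ?majorant_ge0//.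
apply: powR_le; first exact: majorant_ge0.
apply: le_trans (IHt _ _ sj) _; first by rewrite ltnS leq_subr.
(* As the rate is at most 1, it suffices that the exponent at s - j is no smaller than the one with
   [k]: going back at most n steps lowers the quotient by at most one. *)
rewrite ler_wpM2r ?majorant_ge0//; apply: ger_powR; first by rewrite c_gt0.
apply: ler_weXn2l; first exact: p_ge1.
have -> : k = (s.+1 %/ n - 1 - 1)%N by rewrite -subnDA.
rewrite leq_sub2r// leq_subLR add1n.
have -> : ((s - j) %/ n).+1 = ((s - j + n) %/ n)%N.
  by rewrite divnDr// divnn n_gt0 addn1.
by rewrite leq_div2r// -{1}(subnK js) -addnS leq_add2l.
Qed.

End Majorant.

(** * The IGN iteration *)

Section IGN.
Context {R : realType} {d n : nat}.
Variables (n_gt0 : (0 < n)%N) (f : 'cV[R]_d -> 'cV[R]_n) (x0 : 'cV[R]_d).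
Let S := ign f n_gt0 x0.
Let g := compgrad f.

Let sum_update {V : zmodType} (F : 'I_n -> 'cV[R]_d -> V) z k x :
  \sum_i F i (if i == k then x else z i) = \sum_i F i (z i) - F k (z k) + F k x.
Proof.
rewrite (bigD1 k)//= [in RHS](bigD1 k)//= eqxx addrC [F k (z k) + _]addrC addrK.
by congr (_ + _); apply: eq_bigr => i /negPf ->.
Qed.

Lemma ign_uE t : ign_u (S t) = \sum_i ign_term f i (ign_z (S t) i).
Proof.
by elim: t => [//|t IHt]; rewrite /S /= -/S (sum_update (ign_term f)) IHt.
Qed.

Lemma ign_HE t :
  ign_H (S t) = \sum_i g i (ign_z (S t) i) *m (g i (ign_z (S t) i))^T.
Proof.
elim: t => [|t IHt]; last first.
  by rewrite /S /= -/S (sum_update (fun i y => g i y *m (g i y)^T)) IHt.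
apply/matrixP => a b; rewrite summxE !mxE; apply: eq_bigr => i _.
by rewrite !mxE big_ord1 !mxE.
Qed.

Lemma ign_H_sym t : (ign_H (S t))^T = ign_H (S t).
Proof.
rewrite ign_HE linear_sum; apply: eq_bigr => i _.
by rewrite /= trmx_mul trmxK.
Qed.

Lemma dotcv_ign_H t v w : dotcv v (ign_H (S t) *m w) =
  \sum_i dotcv (g i (ign_z (S t) i)) w * dotcv (g i (ign_z (S t) i)) v.
Proof.
rewrite ign_HE mulmx_suml dotcv_sumr; apply: eq_bigr => i _.
by rewrite -mulmxA dotcv_mulmx dotcvE big_ord1 mulrC.
Qed.

Lemma ign_H_step t : ign_H (S t.+1) = ign_H (S t) +
  ign_U f (ign_idx n_gt0 t) (S t) *m (ign_V f (ign_idx n_gt0 t) (S t))^T.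
Proof.
set k := ign_idx n_gt0 t; set a := g k (ign_z (S t) k).
set b := g k (ign_next (S t)).
have := mul_row_col (- a) b a^T b^T; rewrite -tr_row_mx mulNmx => UV.
by rewrite [X in _ + X]UV addrA.
Qed.

Lemma ign_G_step t : ign_H (S t) \in unitmx -> ign_H (S t.+1) \in unitmx ->
  ign_G (S t) = invmx (ign_H (S t)) -> ign_G (S t.+1) = invmx (ign_H (S t.+1)).
Proof.
move=> Hu H'u GE; rewrite -(woodbury_inverse Hu H'u (ign_H_step t)).
by rewrite /S /= /ign_core -/S GE.
Qed.

(** * Coercivity and error bounds near the solution *)

Section Basin.
Variables (L H nu mu : R) (xs : 'cV[R]_d).
Hypotheses (L_gt0 : 0 < L) (H_gt0 : 0 < H) (nu_gt0 : 0 < nu) (mu_gt0 : 0 < mu).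
Hypothesis f_diff : forall x, differentiable f x.
Hypothesis f_xs : f xs = 0.
Hypothesis g_le : forall i x, norm2 (g i x) <= L.
Hypothesis g_holder : forall i x y,
  norm2 (g i x - g i y) <= H * norm2 (x - y) `^ nu.
Hypothesis mu_le : forall v,
  mu ^+ 2 * dotcv v v <= dotcv (jac f xs *m v) (jac f xs *m v).

Let D : R := (mu ^+ 2 / (4 * L * H * n%:R)) `^ nu^-1.
Let basin t := forall i, norm2 (ign_z (S t) i - xs) <= D.

Let nR_gt0 : 0 < n%:R :> R. Proof. by rewrite ltr0n. Qed.

Let D_gt0 : 0 < D.
Proof. by rewrite powR_gt0// divr_gt0 ?exprn_gt0 ?mulr_gt0. Qed.

(** The radius is calibrated by this identity: it produces both the mu^2/2 of the coercivity bound
    and the factor q/n of the majorant recursion. *)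
Let DnuE : H * D `^ nu * n%:R * (4 * L) = mu ^+ 2.
Proof.
rewrite -powRrM mulVf ?gt_eqF// powRr1; last first.
  by rewrite divr_ge0 ?exprn_ge0 ?mulr_ge0 ?ltW.
by field; rewrite !gt_eqF.
Qed.

(** Factor <g_i(xs), v>^2 - <g_i(z_i), v>^2 as a difference of squares: each is at most H D^nu * 2L
    |v|^2, and the n of them sum to at most mu^2/2 |v|^2. *)
Lemma ign_H_coercive t v : basin t ->
  mu ^+ 2 / 2 * dotcv v v <= dotcv v (ign_H (S t) *m v).
Proof.
move=> zD; have := mu_le v.
have -> : dotcv (jac f xs *m v) (jac f xs *m v) = \sum_i dotcv (g i xs) v ^+ 2.
  rewrite dotcvE; apply: eq_bigr => i _; rewrite -expr2; congr (_ ^+ 2).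
  by rewrite dotcvE mxE; apply: eq_bigr => j _; rewrite mxE.
have : \sum_i dotcv (g i xs) v ^+ 2 <=
    \sum_i (dotcv (g i (ign_z (S t) i)) v * dotcv (g i (ign_z (S t) i)) v +
      H * D `^ nu * (2 * L) * dotcv v v).
  apply: ler_sum => i _; set z := ign_z _ i.
  have b1 : `|dotcv (g i xs - g i z) v| <= H * D `^ nu * norm2 v.
    apply: le_trans (cauchy_schwarz _ _) _; rewrite ler_wpM2r ?norm2_ge0//.
    rewrite -opprB -scaleN1r norm2Z normrN1 mul1r.
    apply: le_trans (g_holder _ _ _) _; rewrite ler_pM2l//.
    apply: ge0_ler_powR; last exact: zD.
    - exact: ltW.
    - by rewrite nnegrE norm2_ge0.
    - by rewrite nnegrE ltW.
  have b2 : `|dotcv (g i xs + g i z) v| <= 2 * L * norm2 v.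
    rewrite dotcvDl; apply: le_trans (ler_normD _ _) _.
    rewrite -mulrA mulr_natl mulr2n; apply: lerD.
      by apply: le_trans (cauchy_schwarz _ _) _; rewrite ler_wpM2r ?norm2_ge0.
    by apply: le_trans (cauchy_schwarz _ _) _; rewrite ler_wpM2r ?norm2_ge0.
  have := ler_pM (normr_ge0 _) (normr_ge0 _) b1 b2; rewrite -normrM.
  move=> /(le_trans (ler_norm _)).
  rewrite !dotcvDl dotcvNl -sqr_norm2.
  lra.
rewrite big_split /= sumr_const card_ord -mulr_natr dotcv_ign_H.
have := DnuE.
set A := \sum_(i < n) _ * _; set B := \sum_(i < n) _; set Q := dotcv v v.
move=> <- h1 h2; apply: (@le_trans _ _ (H * D `^ nu * n%:R * (4 * L) * Q -
  H * D `^ nu * (2 * L) * Q * n%:R)); lra.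
Qed.

Lemma ign_loewner t : basin t -> loewner_ge (ign_H (S t)) (mu ^+ 2 / 2)%:M.
Proof.
move=> zD; split=> [|v]; first by rewrite linearB /= ign_H_sym tr_scalar_mx.
rewrite mulmxBl mul_scalar_mx dotcvDr dotcvNr dotcvZr subr_ge0.
exact: ign_H_coercive.
Qed.

Lemma ign_H_unit t : basin t -> ign_H (S t) \in unitmx.
Proof.
move=> zD; rewrite -row_free_unit -kermx_eq0.
apply/rowV0P => v /sub_kermxP vH.
have : v^T == 0.
  rewrite -dotcv_eq0 eq_le dotcv_ge0 andbT.
  have := ign_H_coercive v^T zD.
  rewrite -ign_H_sym -trmx_mul vH trmx0.
  rewrite [X in _ <= X](_ : _ = 0); last by rewrite /dotcv mulmx0 mxE.
  by rewrite pmulr_rle0// divr_gt0 ?exprn_gt0.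
by move=> /eqP vT0; rewrite -[v]trmxK vT0 trmx0.
Qed.

Lemma ign_core_sigma_min t : basin t -> basin t.+1 ->
  ign_G (S t) = invmx (ign_H (S t)) ->
  0 < sigma_min (ign_core f (ign_idx n_gt0 t) (S t)).
Proof.
move=> zD z'D GE; apply: sigma_min_gt0 => //; rewrite /ign_core GE.
exact: woodbury_core_unit (ign_H_unit zD) (ign_H_unit z'D) (ign_H_step t).
Qed.

(** With w the new error, H^t w = u^t - H^t xs. Because f vanishes at [xs], this is the sum of the
    linearization errors of f_i from z_i to [xs], weighted by the gradients. Pair with w, bound
    below by coercivity, and cancel |w|. *)
Lemma ign_next_error t : basin t -> ign_G (S t) = invmx (ign_H (S t)) ->
  norm2 (ign_x (S t.+1) - xs) <= 2 * L * H / (mu ^+ 2 * (1 + nu)) *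
    \sum_i norm2 (ign_z (S t) i - xs) `^ (1 + nu).
Proof.
move=> zD GE; set w := _ - xs.
have Hw : dotcv w (ign_H (S t) *m w) = \sum_i
    (f xs i 0 - f (ign_z (S t) i) i 0 -
     dotcv (g i (ign_z (S t) i)) (xs - ign_z (S t) i)) *
    dotcv (g i (ign_z (S t) i)) w.
  have HwE : ign_H (S t) *m w = ign_u (S t) - ign_H (S t) *m xs.
    rewrite mulmxBr /S /= -/S /ign_next GE mulmxA mulmxV ?mul1mx//.
    exact: ign_H_unit.
  rewrite HwE dotcvDr dotcvNr dotcv_ign_H ign_uE dotcv_sumr -sumrB.
  apply: eq_bigr => i _; rewrite /ign_term dotcvZr [dotcv w _]dotcvC -mulrBl.
  by rewrite f_xs mxE -/g dotcvDr dotcvNr; congr (_ * _); ring.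
have w2 : mu ^+ 2 / 2 * norm2 w ^+ 2 <= H / (1 + nu) * L *
    (\sum_i norm2 (ign_z (S t) i - xs) `^ (1 + nu)) * norm2 w.
  rewrite sqr_norm2; apply: le_trans (ign_H_coercive w zD) _; rewrite Hw.
  rewrite mulr_sumr mulr_suml; apply: ler_sum => i _.
  apply: le_trans (ler_norm _) _; rewrite normrM.
  rewrite [H / _ * L * _]mulrAC -[leRHS]mulrA.
  apply: ler_pM => //.
    exact: (linearization_error_le f_diff _ _ nu_gt0 (ltW H_gt0) (@g_holder i)).
  by apply: le_trans (cauchy_schwarz _ _) _; rewrite ler_wpM2r ?norm2_ge0.
have nu1 : 0 < 1 + nu by rewrite addr_gt0.
have := norm2_ge0 w; rewrite le_eqVlt => /predU1P[<-|w0].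
  apply: mulr_ge0; first by rewrite ltW// divr_gt0 ?mulr_gt0 ?exprn_gt0.
  by apply: sumr_ge0 => i _; exact: powR_ge0.
rewrite expr2 mulrA ler_pM2r// in w2.
rewrite -(@ler_pM2l _ (mu ^+ 2 / 2)) ?divr_gt0 ?exprn_gt0//.
apply: le_trans w2 _; rewrite le_eqVlt; apply/orP; left; apply/eqP.
by field; rewrite !gt_eqF.
Qed.

(** The three claims need one another: the next error bound uses the basin and the exact inverse at
    t. The z_i are past iterates, so error bounds up to t give the basin at t, and the inverse
    carries over once H^t and H^{t+1} are both invertible. *)
Lemma ign_invariant : norm2 (x0 - xs) <= D -> forall t,
  [/\ forall s, (s <= t)%N -> norm2 (ign_x (S s) - xs) <= D * majorant n nu s,
      basin t & ign_G (S t) = invmx (ign_H (S t))].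
Proof.
move=> x0D.
have zE : forall t i,
    ign_z (S t) i = ign_x (S (t - (t + (n - i.+1)) %% n)).
  move=> t i.
  exact: (@cyclic_updateE _ _ n_gt0 (fun t => ign_x (S t))
    (fun t => ign_z (S t))).
have basinP t : (forall s, (s <= t)%N ->
    norm2 (ign_x (S s) - xs) <= D * majorant n nu s) -> basin t.
  move=> xD i; rewrite zE; apply: le_trans (xD _ (leq_subr _ _)) _.
  by rewrite ler_piMr ?(ltW D_gt0)// majorant_le1.
elim=> [|t [xD zD GE]].
  have xD s : (s <= 0)%N -> norm2 (ign_x (S s) - xs) <= D * majorant n nu s.
    by rewrite leqn0 => /eqP ->; rewrite mulr1.
  by split=> //; exact: basinP.
have xD' s : (s <= t.+1)%N -> norm2 (ign_x (S s) - xs) <= D * majorant n nu s.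
  rewrite leq_eqVlt => /predU1P[->|]; last by rewrite ltnS; exact: xD.
  apply: le_trans (ign_next_error zD GE) _; rewrite majorantS.
  rewrite (@sum_cyclic_update _ _ n_gt0 (fun t => ign_x (S t))
    (fun t => ign_z (S t)) _ _ _ (fun y => norm2 (y - xs) `^ (1 + nu)))//.
  have nu1 : 0 < 1 + nu by rewrite addr_gt0.
  rewrite mulrA !mulr_sumr; apply: ler_sum => j _.
  have h : norm2 (ign_x (S (t - j)) - xs) `^ (1 + nu) <=
      D * D `^ nu * majorant n nu (t - j) `^ (1 + nu).
    have -> : D * D `^ nu = D `^ (1 + nu).
      by rewrite powRD ?(gt_eqF D_gt0) ?implybT// powRr1// ltW.
    rewrite -powRM ?(ltW D_gt0) ?majorant_ge0//.
    apply: ge0_ler_powR; rewrite ?nnegrE ?norm2_ge0 ?(ltW nu1)//.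
      by rewrite mulr_ge0 ?majorant_ge0 ?(ltW D_gt0).
    by apply: xD; rewrite leq_subr.
  (* Substituting mu^2 = 4 L H n D^nu turns 2 L H D^nu / (mu^2 (1 + nu)) into 1 / (2 (1 + nu) n),
     the coefficient in [majorantS]. *)
  rewrite -DnuE.
  have Dnu0 : 0 < D `^ nu by rewrite powR_gt0.
  have C0 : 0 < 2 * L * H / (H * D `^ nu * n%:R * (4 * L) * (1 + nu)).
    by rewrite divr_gt0 ?mulr_gt0.
  rewrite -(ler_pM2l C0) in h; apply: le_trans h _.
  rewrite le_eqVlt; apply/orP; left; apply/eqP.
  by field; rewrite !gt_eqF.
have zD' := basinP _ xD'.
by split=> //; apply: ign_G_step GE; exact: ign_H_unit.
Qed.

End Basin.

End IGN.

Theorem theorem1 (R : realType) (d n : nat) (hd : (1 <= d)%N) (hdn : (d <= n)%N)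
    (f : 'cV[R]_d -> 'cV[R]_n)
    (hf : forall x : 'cV[R]_d, differentiable f x)
    (Lf : R) (hLf : 0 < Lf)
    (hlip : forall x y : 'cV[R]_d, norm2 (f x - f y) <= Lf * norm2 (x - y))
    (nu Hnu : R) (hnu : 0 < nu <= 1) (hHnu : 0 < Hnu)
    (hhol : forall x y : 'cV[R]_d,
      spectral_norm (jac f x - jac f y) <= Hnu * norm2 (x - y) `^ nu)
    (xs : 'cV[R]_d) (hxs : f xs = 0)
    (mu : R) (hmu : mu = sigma_min (jac f xs)) (hmu0 : 0 < mu)
    (x0 : 'cV[R]_d)
    (hx0 : norm2 (x0 - xs) <= (mu ^+ 2 / (4 * Lf * Hnu * n%:R)) `^ nu^-1) :
  let n_gt0 : (0 < n)%N := leq_trans hd hdn in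
  let S : nat -> ign_state R d n := ign f n_gt0 x0 in
  (forall t : nat,
     loewner_ge (ign_H (S t)) (mu ^+ 2 / 2)%:M /\
     let U := ign_U f (ign_idx n_gt0 t) (S t) in
     let V := ign_V f (ign_idx n_gt0 t) (S t) in
     0 < sigma_min (1%:M + V^T *m ign_G (S t) *m U)) /\
  exists r : nat -> R,
    (forall t : nat, norm2 (ign_x (S t) - xs) <= r t) /\
    (forall t : nat, (n <= t)%N ->
       r t.+1 <= ign_rate n nu `^ ((1 + nu) ^+ (t %/ n - 1)) * r t).
Proof.
move=> n_gt0 S; have /andP[nu_gt0 _] := hnu.
have dn : (0 < d <= n)%N by rewrite hd.
have g_le i x := norm2_compgrad_le i hf x (ltW hLf) hlip.
have g_holder i x y := le_trans (norm2_compgradB_le f i x y dn) (hhol x y).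
have mu_le v := sigma_min_le_gram (jac f xs) v dn.
rewrite -hmu in mu_le.
have inv := ign_invariant n_gt0 hLf hHnu nu_gt0 hmu0 hf hxs g_le g_holder
  mu_le hx0.
split=> [t|].
  (* The core matrix at t is invertible because H^{t+1} is, hence the invariant at [t.+1] as
     well. *)
  have [_ zD GE] := inv t; have [_ zD' _] := inv t.+1; split.
    exact: (ign_loewner hLf hHnu nu_gt0 hmu0 g_le g_holder mu_le zD).
  exact: (ign_core_sigma_min hLf hHnu nu_gt0 hmu0 g_le g_holder mu_le
    zD zD' GE).
exists (fun t => (mu ^+ 2 / (4 * Lf * Hnu * n%:R)) `^ nu^-1 * majorant n nu t).
split=> t; first by have [xD _ _] := inv t; exact: xD.
move=> nt; rewrite [leRHS]mulrCA ler_wpM2l ?powR_ge0//.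
exact: majorant_superlinear.
Qed.
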